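(* Let $X$ be an infinite-dimensional complex Banach space and let $T$ be a generalized Drazin invertible bounded linear operator on $X$ with generalized Drazin inverse $T^D$. Then $T$ has property $(C)$ if and only if $T^D$ has property $(C)$.
   Context: A bounded operator $T$ on $X$ is generalized Drazin invertible if there is a bounded operator $S$ on $X$ with $ST=TS$, $STS=S$ and $TST=T+U$ with $U$ quasinilpotent (equivalently, $0$ is not an accumulation point of $\sigma(T)$). Such $S$ is unique; it is called the generalized Drazin inverse of $T$ and denoted $T^D$. The local resolvent set $\rho_T(x)$ of $T$ at $x\in X$ is the union of all open sets $U\subseteq\mathbb{C}$ for which there is an analytic function $f:U\to X$ with $(\lambda I-T)f(\lambda)=x$ for all $\lambda\in U$; the local spectrum is $\sigma_T(x)=\mathbb{C}\setminus\rho_T(x)$. For $\Omega\subseteq\mathbb{C}$, the local spectral subspace is $X_T(\Omega)=\{x\in X:\sigma_T(x)\subset\Omega\}$. $T$ has (Dunford's) property $(C)$ if $X_T(\Omega)$ is closed for every closed set $\Omega\subseteq\mathbb{C}$. *)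

(* Defs.v *)
From Stdlib Require Import Reals.
From Coquelicot Require Export Coquelicot.

(* Coquelicot's [is_linear] includes the bound [norm (l x) <= M * norm x], so
   a bounded operator on [X] is a map [T : X -> X] with [is_linear T]. *)

(* [sum_n a n] has the [n + 1] terms [a 0, ..., a n]; a family of vectors may
   contain [zero], so this covers every finite spanning family, even empty. *)
Definition finite_dimensional {K : AbsRing} (X : NormedModule K) : Prop :=
  exists (n : nat) (v : nat -> X),
    forall x : X, exists c : nat -> K, x = sum_n (fun k => scal (c k) (v k)) n.

Section Operators.

Context {X : NormedModule C_AbsRing}.

Definition shift (T : X -> X) (lambda : C) (x : X) : X :=
  minus (scal lambda x) (T x).

Definition invertible (A : X -> X) : Prop :=
  exists B : X -> X,
    is_linear B /\ (forall x, B (A x) = x) /\ (forall x, A (B x) = x).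

Definition spectrum (T : X -> X) (lambda : C) : Prop :=
  ~ invertible (shift T lambda).

Definition quasinilpotent (T : X -> X) : Prop :=
  forall lambda : C, spectrum T lambda <-> lambda = RtoC 0.

Definition is_gen_Drazin_inverse (T S : X -> X) : Prop :=
  is_linear S /\
  (forall x, S (T x) = T (S x)) /\
  (forall x, S (T (S x)) = S x) /\
  exists U : X -> X,
    is_linear U /\ quasinilpotent U /\
    forall x, T (S (T x)) = plus (T x) (U x).

(* [f] is total, but on an open set differentiability and the values of [f]
   do not depend on what [f] is outside the set. *)
Definition analytic_on (U : C -> Prop) (f : C -> X) : Prop :=
  forall z : C, U z -> ex_derive (K := C_AbsRing) f z.

Definition local_resolvent_set (T : X -> X) (x : X) (lambda : C) : Prop :=
  exists U : C -> Prop,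
    open U /\ U lambda /\
    exists f : C -> X,
      analytic_on U f /\ forall mu : C, U mu -> shift T mu (f mu) = x.

Definition local_spectrum (T : X -> X) (x : X) (lambda : C) : Prop :=
  ~ local_resolvent_set T x lambda.

Definition local_spectral_subspace (T : X -> X) (Omega : C -> Prop) (x : X) :
    Prop :=
  forall lambda : C, local_spectrum T x lambda -> Omega lambda.

Definition property_C (T : X -> X) : Prop :=
  forall Omega : C -> Prop,
    closed Omega -> closed (local_spectral_subspace T Omega).

End Operators.

(* Main.v *)
Require Import Defs.
From Stdlib Require Import Reals Lra List Classical ClassicalEpsilon.
From Coquelicot Require Import Coquelicot.

Local Open Scope C_scope.

(** Put [P = T TD] and [E = 1 - P].  [P] is a projection commuting with [T] and
    [TD]; on its range [T] and [TD] are inverse to each other, while on its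
    kernel [T] is quasinilpotent and [TD] is [0].  The two operators enter
    symmetrically once only this is kept: [T] and [S] commute with a projection
    [P], are inverse to each other on its range, and [z - T E], [z - S E] are
    invertible for every [z <> 0] ([drazin_pair]).  So it is enough to pass
    property (C) from [T] to [S].

    Off the origin, [z] lies in the local resolvent set of [x] for [T] exactly
    when [1/z] does for [S] ([local_resolvent_Cinv]): the kernel part of [x] has
    a local resolvent at every nonzero point, and on the range of [P] the local
    resolvent of [S] at [1/z] is an explicit expression in the one of [T] at
    [z].  At the origin, [0] is in the local resolvent set of [x] for [S]
    exactly when [P x = x]: one implication is the Neumann series
    ([local_resolvent_at_0]), the other says that a quasinilpotent operator has
    no local resolvent at [0] except for the zero vector
    ([proj_of_local_resolvent_0]).  Hence, with [Omega'] the closed set of the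
    [z] such that [z = 0] or [1/z] is in [Omega], the subspace of [S] for
    [Omega] is the subspace of [T] for [Omega'] when [0] is in [Omega], and its
    intersection with the closed subspace of fixed points of [P] otherwise.

    The claim on quasinilpotent operators is a Liouville theorem: the resolvent
    [z => (z - N)^-1 y] would extend continuously to [0] and it vanishes at
    infinity, so the invariance of its circle means forces the value [0] at [0],
    and then [y = - N 0 = 0].  The means are taken
    over finitely many points [z w^k], with [w] a root of unity close to [1]; they
    vary little with the radius, because the radial increment of a holomorphic
    function is, to first order, a multiple of its increment under the rotation
    by [w], and the latter increments telescope to [0] around the circle
    ([circle_sum_step], [circle_means_agree]). *)

(** * Linear identities in a complex vector space *)

(** Linear combinations are normalized by reflection: [veval] interprets a
    syntactic combination of atoms, and two combinations agree as soon as the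
    coefficients of every atom do, which are identities in [C]. *)
Inductive vexp :=
  | VAtom (i : nat)
  | VZero
  | VPlus (e f : vexp)
  | VOpp (e : vexp)
  | VScal (c : C) (e : vexp).

Fixpoint coeff (e : vexp) (i : nat) : C :=
  match e with
  | VAtom j => if Nat.eqb j i then 1 else 0
  | VZero => 0
  | VPlus e f => coeff e i + coeff f i
  | VOpp e => - coeff e i
  | VScal c e => c * coeff e i
  end.

Section Module_normalization.

Context {X : ModuleSpace C_AbsRing}.

Fixpoint veval (env : list X) (e : vexp) : X :=
  match e with
  | VAtom i => nth i env zero
  | VZero => zero
  | VPlus e f => plus (veval env e) (veval env f)
  | VOpp e => opp (veval env e)
  | VScal c e => scal (V := X) c (veval env e)
  end.

Fixpoint lincomb (c : nat -> C) (env : list X) : X :=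
  match env with
  | nil => zero
  | x :: env' => plus (scal (V := X) (c 0%nat) x) (lincomb (fun i => c (S i)) env')
  end.

Fixpoint same_coeffs (c d : nat -> C) (env : list X) : Prop :=
  match env with
  | nil => True
  | _ :: env' =>
      c 0%nat = d 0%nat /\ same_coeffs (fun i => c (S i)) (fun i => d (S i)) env'
  end.

Lemma lincomb_same (c d : nat -> C) (env : list X) :
  same_coeffs c d env -> lincomb c env = lincomb d env.
Proof.
  revert c d; induction env as [|x env IH]; intros c d; simpl; [easy|].
  intros [-> H]; now rewrite (IH _ _ H).
Qed.

Lemma lincomb_zero (env : list X) : lincomb (fun _ => 0) env = zero.
Proof.
  induction env as [|x env IH]; simpl; [easy|].
  rewrite IH, plus_zero_r; exact (scal_zero_l (V := X) x).
Qed.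

Lemma lincomb_plus (c d : nat -> C) (env : list X) :
  lincomb (fun i => c i + d i) env = plus (lincomb c env) (lincomb d env).
Proof.
  revert c d; induction env as [|x env IH]; intros c d; simpl.
  - now rewrite plus_zero_l.
  - rewrite (IH (fun i => c (S i)) (fun i => d (S i))).
    replace (scal (V := X) (c 0%nat + d 0%nat) x)
      with (plus (scal (V := X) (c 0%nat) x) (scal (V := X) (d 0%nat) x))
      by (symmetry; exact (scal_distr_r (V := X) (c 0%nat) (d 0%nat) x)).
    rewrite <- !plus_assoc; f_equal.
    rewrite !plus_assoc; f_equal; apply plus_comm.
Qed.

Lemma lincomb_scal (a : C) (c : nat -> C) (env : list X) :
  lincomb (fun i => a * c i) env = scal (V := X) a (lincomb c env).
Proof.
  revert c; induction env as [|x env IH]; intros c; simpl.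
  - symmetry; exact (scal_zero_r (V := X) a).
  - rewrite (IH (fun i => c (S i))), scal_distr_l; f_equal.
    symmetry; exact (scal_assoc (V := X) a (c 0%nat) x).
Qed.

Lemma lincomb_opp (c : nat -> C) (env : list X) :
  lincomb (fun i => - c i) env = opp (lincomb c env).
Proof.
  revert c; induction env as [|x env IH]; intros c; simpl.
  - symmetry; exact opp_zero.
  - rewrite (IH (fun i => c (S i))).
    refine (eq_trans _ (eq_sym (opp_plus (G := ModuleSpace.AbelianGroup _ X) _ _))).
    f_equal; exact (scal_opp_l (V := X) (c 0%nat) x).
Qed.

Lemma lincomb_atom (i : nat) (env : list X) :
  lincomb (fun j => if Nat.eqb i j then 1 else 0) env = nth i env zero.
Proof.
  revert i; induction env as [|x env IH]; intros [|i]; simpl; try easy.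
  - rewrite lincomb_zero, plus_zero_r; exact (scal_one (V := X) x).
  - rewrite IH.
    replace (scal (V := X) (RtoC 0) x) with (zero : X).
    + apply plus_zero_l.
    + symmetry; exact (scal_zero_l (V := X) x).
Qed.

Lemma veval_lincomb (env : list X) (e : vexp) :
  veval env e = lincomb (coeff e) env.
Proof.
  induction e as [i| |e IHe f IHf|e IHe|c e IHe]; simpl.
  - symmetry; apply lincomb_atom.
  - symmetry; apply lincomb_zero.
  - now rewrite lincomb_plus, IHe, IHf.
  - now rewrite lincomb_opp, IHe.
  - now rewrite lincomb_scal, IHe.
Qed.

Lemma veval_eq (env : list X) (e f : vexp) :
  same_coeffs (coeff e) (coeff f) env -> veval env e = veval env f.
Proof. intros H; rewrite !veval_lincomb; now apply lincomb_same. Qed.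

End Module_normalization.

Ltac vmem x env :=
  lazymatch env with
  | nil => false
  | x :: _ => true
  | _ :: ?env' => vmem x env'
  end.

Ltac vatoms t env :=
  lazymatch t with
  | plus ?a ?b => let env := vatoms a env in vatoms b env
  | minus ?a ?b => let env := vatoms a env in vatoms b env
  | opp ?a => vatoms a env
  | scal _ ?a => vatoms a env
  | zero => env
  | _ => lazymatch vmem t env with true => env | false => constr:(t :: env) end
  end.

Ltac vindex x env :=
  lazymatch env with
  | x :: _ => constr:(0%nat)
  | _ :: ?env' => let i := vindex x env' in constr:(S i)
  end.

Ltac vreify t env :=
  lazymatch t with
  | plus ?a ?b =>
      let a := vreify a env in let b := vreify b env in constr:(VPlus a b)
  | minus ?a ?b =>
      let a := vreify a env in let b := vreify b env in constr:(VPlus a (VOpp b))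
  | opp ?a => let a := vreify a env in constr:(VOpp a)
  | scal ?c ?a => let a := vreify a env in constr:(VScal c a)
  | zero => constr:(VZero)
  | _ => let i := vindex t env in constr:(VAtom i)
  end.

(** Reduces an equation between linear combinations to the equality of the
    coefficients of each atom. *)
Ltac module_coeffs :=
  lazymatch goal with
  | |- @eq ?V ?a ?b =>
      let env := vatoms a (@nil V) in
      let env := vatoms b env in
      let ea := vreify a env in
      let eb := vreify b env in
      change (veval env ea = veval env eb);
      apply veval_eq; cbn [same_coeffs coeff Nat.eqb]; repeat split
  end.

Ltac module_ring := module_coeffs; ring.
Ltac module_field := module_coeffs; field.


(** * Differentiation with respect to a complex variable *)

(** The neighbourhoods of [z] are those of the product topology of the plane,
    whose balls are squares; differentiability refers to the absolute value
    instead. *)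
Lemma locally_Cmod (z : C) (P : C -> Prop) :
  locally z P <->
  exists d : R, (0 < d)%R /\ forall w : C, (Cmod (w - z) < d)%R -> P w.
Proof.
  split; intros H.
  - apply locally_C in H; destruct H as [d H].
    exists d; split; [apply cond_pos|].
    intros w Hw; apply H; exact Hw.
  - destruct H as [d [Hd H]]; apply locally_C.
    exists (mkposreal d Hd); intros w Hw; apply H; exact Hw.
Qed.

Lemma norm_scal_C {X : NormedModule C_AbsRing} (z : C) (x : X) :
  (norm (scal (V := X) z x) <= Cmod z * norm x)%R.
Proof. exact (norm_scal z x). Qed.

Lemma is_derive_of_quadratic_bound {X : NormedModule C_AbsRing}
    (f : C -> X) (z : C) (l : X) (K : R) :
  locally z (fun w : C => norm (minus (minus (f w) (f z)) (scal (V := X) (w - z)%C l))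
                      <= K * (Cmod (w - z) * Cmod (w - z)))%R ->
  is_derive (K := C_AbsRing) f z l.
Proof.
  intros H; split; [apply is_linear_scal_l|].
  intros x Hx.
  assert (E : z = x)
    by exact (is_filter_lim_locally_unique (V := AbsRing_NormedModule C_AbsRing) z x Hx).
  subst x; clear Hx.
  intros eps.
  apply locally_Cmod in H; destruct H as [d [Hd H]].
  apply (locally_C z).
  apply locally_Cmod.
  assert (HK : (0 < Rabs K + 1)%R) by (generalize (Rabs_pos K); lra).
  exists (Rmin d (eps / (Rabs K + 1))%R); split.
  - apply Rmin_pos; [easy|]. apply Rdiv_lt_0_compat; [apply cond_pos|easy].
  - intros w Hw.
    eapply Rle_trans; [apply H; eapply Rlt_le_trans; [exact Hw|apply Rmin_l]|].
    change (K * (Cmod (w - z) * Cmod (w - z)) <= eps * Cmod (w - z))%R.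
    rewrite <- Rmult_assoc; apply Rmult_le_compat_r; [apply Cmod_ge_0|].
    assert (Hw' : (Cmod (w - z) <= eps / (Rabs K + 1))%R)
      by (apply Rlt_le, (Rlt_le_trans _ _ _ Hw), Rmin_r).
    apply Rle_trans with ((Rabs K + 1) * (eps / (Rabs K + 1)))%R.
    + apply Rle_trans with ((Rabs K + 1) * Cmod (w - z))%R.
      * apply Rmult_le_compat_r; [apply Cmod_ge_0|].
        generalize (Rle_abs K); lra.
      * apply Rmult_le_compat_l; lra.
    + right; field; lra.
Qed.

Lemma ex_derive_Cinv (z : C) :
  z <> 0 -> ex_derive (K := C_AbsRing) (V := AbsRing_NormedModule C_AbsRing) Cinv z.
Proof.
  intros Hz.
  assert (Hpos : (0 < Cmod z)%R) by now apply Cmod_gt_0.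
  exists (- / (z * z)).
  apply (is_derive_of_quadratic_bound (X := AbsRing_NormedModule C_AbsRing))
    with (K := (2 * / (Cmod z * Cmod z * Cmod z))%R).
  apply locally_Cmod; exists (Cmod z / 2)%R; split; [lra|].
  intros w Hw.
  assert (Hwz : (Cmod z / 2 <= Cmod w)%R).
  { generalize (Cmod_triangle w (z - w)); replace (w + (z - w)) with z by ring.
    rewrite <- (Cmod_opp (z - w)); replace (- (z - w)) with (w - z) by ring; lra. }
  assert (Hw0 : w <> 0) by (apply Cmod_gt_0; lra).
  change (Cmod (((/ w) - / z) - ((w - z) * - / (z * z))) <=
          2 * / (Cmod z * Cmod z * Cmod z) * (Cmod (w - z) * Cmod (w - z)))%R.
  replace (((/ w) - / z) - ((w - z) * - / (z * z)))
    with ((w - z) * (w - z) * / (w * z * z)) by (field; auto).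
  rewrite !Cmod_mult, Cmod_inv, !Cmod_mult
    by (repeat apply Cmult_neq_0; auto).
  rewrite Rmult_comm; apply Rmult_le_compat_r.
  - apply Rmult_le_pos; apply Cmod_ge_0.
  - apply Rle_trans with (/ ((Cmod z / 2) * Cmod z * Cmod z))%R.
    + apply Rinv_le_contravar.
      * repeat apply Rmult_lt_0_compat; lra.
      * repeat apply Rmult_le_compat_r; lra.
    + right; field; lra.
Qed.

(** * Bounded inverses *)

Section Inverses.

Context {X : NormedModule C_AbsRing}.

Lemma lin_zero (A : X -> X) : is_linear A -> A zero = zero.
Proof.
  intros HA.
  replace (zero : X) with (scal (V := X) (RtoC 0) zero) at 1 by module_ring.
  rewrite (linear_scal _ HA); module_ring.
Qed.

Lemma lin_opp (A : X -> X) (x : X) : is_linear A -> A (opp x) = opp (A x).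
Proof.
  intros HA.
  replace (opp x) with (scal (V := X) (- (1)) x) by module_ring.
  rewrite (linear_scal _ HA); module_ring.
Qed.

Lemma lin_minus (A : X -> X) (x y : X) :
  is_linear A -> A (minus x y) = minus (A x) (A y).
Proof.
  intros HA; unfold minus; now rewrite (linear_plus _ HA), lin_opp.
Qed.

Lemma is_linear_plus_fun (A B : X -> X) :
  is_linear A -> is_linear B -> is_linear (fun x => plus (A x) (B x)).
Proof.
  intros HA HB.
  apply (is_linear_comp (fun x => (A x, B x)) (fun t => plus (fst t) (snd t))).
  - now apply is_linear_prod.
  - apply is_linear_plus.
Qed.

Lemma is_linear_scaled (c : C) (A : X -> X) :
  is_linear A -> is_linear (fun x => scal (V := X) c (A x)).
Proof.
  intros HA; apply (is_linear_comp A (fun x => scal (V := X) c x)); [easy|].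
  apply is_linear_scal_r; exact Cmult_comm.
Qed.

Lemma is_linear_minus (A B : X -> X) :
  is_linear A -> is_linear B -> is_linear (fun x => minus (A x) (B x)).
Proof.
  intros HA HB.
  apply is_linear_plus_fun; [easy|].
  apply (is_linear_comp B (opp (G := X))); [easy|apply is_linear_opp].
Qed.

Lemma is_linear_shift (A : X -> X) (z : C) :
  is_linear A -> is_linear (shift A z).
Proof.
  intros HA; apply is_linear_minus; [|easy].
  apply (is_linear_scaled z (fun x => x)), is_linear_id.
Qed.

(** The lower bound makes [A] injective, and bounds the inverse that
    surjectivity then provides. *)
Lemma invertible_of_bounded_below (A : X -> X) (c : R) :
  is_linear A -> (0 < c)%R -> (forall x, c * norm x <= norm (A x))%R ->
  (forall y, exists x, A x = y) -> invertible A.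
Proof.
  intros HA Hc Hbelow Hsurj.
  assert (Hinj : forall x y, A x = A y -> x = y).
  { intros x y Hxy.
    assert (H := Hbelow (minus x y)).
    rewrite (lin_minus A x y HA), Hxy in H.
    replace (minus (A y) (A y)) with (zero : X) in H by module_ring.
    assert (N0 : norm (zero : X) = 0%R) by exact norm_zero.
    rewrite N0 in H.
    assert (H0 : norm (minus x y) = 0%R).
    { apply Rle_antisym; [|apply norm_ge_0].
      apply (Rmult_le_reg_l c); lra. }
    apply norm_eq_zero in H0.
    replace x with (plus y (minus x y)) by module_ring.
    rewrite H0; module_ring. }
  destruct (choice (fun y x => A x = y) Hsurj) as [B HB].
  exists B; split; [|split].
  - split.
    + intros x y; apply Hinj; now rewrite (linear_plus _ HA), !HB.
    + intros k x; apply Hinj; now rewrite (linear_scal _ HA), !HB.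
    + exists (/ c)%R; split; [now apply Rinv_0_lt_compat|].
      intros x; apply (Rmult_le_reg_l c); [easy|].
      rewrite <- Rmult_assoc, Rinv_r, Rmult_1_l by lra.
      rewrite <- (HB x) at 2; apply Hbelow.
  - intros x; now apply Hinj.
  - easy.
Qed.

(** The two families of operators to be inverted, [z - A] and [1 - z A], depend
    affinely on [z]; both are treated at once, [B] being the slope. *)
Definition affine_family (B : X -> X) (F : C -> X -> X) : Prop :=
  forall (w z : C) (x : X), F w x = plus (F z x) (scal (V := X) (w - z) (B x)).

Definition inverse_family (U : C -> Prop) (F Q : C -> X -> X) : Prop :=
  forall z, U z ->
    is_linear (Q z) /\ (forall x, Q z (F z x) = x) /\ (forall x, F z (Q z x) = x).

Lemma ex_inverse_family (U : C -> Prop) (F : C -> X -> X) :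
  (forall z, U z -> invertible (F z)) -> exists Q, inverse_family U F Q.
Proof.
  intros H.
  apply (choice (fun z B => U z -> is_linear B /\ (forall x, B (F z x) = x) /\
                                   (forall x, F z (B x) = x))).
  intros z; destruct (classic (U z)) as [Hz|Hz].
  - destruct (H z Hz) as [B HB]; now exists B.
  - exists (fun x => x); easy.
Qed.

Context (U : C -> Prop) (B : X -> X) (F Q : C -> X -> X).
Context (HB : is_linear B) (HF : affine_family B F) (HQ : inverse_family U F Q).

Lemma resolvent_identity (w z : C) (y : X) :
  U w -> U z -> Q w y = minus (Q z y) (scal (V := X) (w - z) (Q w (B (Q z y)))).
Proof.
  intros Hw Hz.
  destruct (HQ w Hw) as [Lw [Iw _]], (HQ z Hz) as [_ [_ Iz]].
  assert (E : Q w (F w (Q z y)) = Q z y) by apply Iw.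
  rewrite (HF w z), Iz, (linear_plus _ Lw), (linear_scal _ Lw) in E.
  rewrite <- E at 1; module_ring.
Qed.

(** Applying the resolvent identity twice leaves the remainder
    [(w - z)^2 Q_w B Q_z B Q_z y], so the quadratic error is explicit in a common
    bound for [Q_w] and [Q_z].  This gives differentiability, and uniformity over
    an annulus is what the comparison of circle means requires. *)
Lemma inverse_family_quadratic (w z : C) (y : X) (M b : R) :
  U w -> U z -> (0 <= M)%R -> (0 <= b)%R ->
  (forall x, norm (Q w x) <= M * norm x)%R ->
  (forall x, norm (Q z x) <= M * norm x)%R ->
  (forall x, norm (B x) <= b * norm x)%R ->
  (norm (minus (minus (Q w y) (Q z y)) (scal (V := X) (w - z)%C (opp (Q z (B (Q z y))))))
   <= M * (b * (M * (b * (M * norm y)))) * (Cmod (w - z) * Cmod (w - z)))%R.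
Proof.
  intros Hw Hz HM Hb Bw Bz BB.
  set (v := Q w (B (Q z (B (Q z y))))).
  assert (E : minus (minus (Q w y) (Q z y)) (scal (V := X) (w - z) (opp (Q z (B (Q z y)))))
              = scal (V := X) ((w - z) * (w - z)) v).
  { rewrite (resolvent_identity w z y Hw Hz).
    rewrite (resolvent_identity w z (B (Q z y)) Hw Hz).
    fold v; module_ring. }
  rewrite E, Rmult_comm, <- Cmod_mult.
  eapply Rle_trans; [apply norm_scal_C|].
  apply Rmult_le_compat_l; [apply Cmod_ge_0|].
  unfold v.
  repeat (eapply Rle_trans; [apply Bw || apply Bz || apply BB|];
          apply Rmult_le_compat_l; [easy|]).
  right; reflexivity.
Qed.

(** By the resolvent identity read backwards,
    [|Q_w x| <= |Q_z x| + |z - w| |Q_z B| |Q_w x|], where the last term is absorbed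
    on the left once [|z - w| |Q_z B| <= 1/2]. *)
Lemma inverse_family_locally_bounded (z : C) :
  U z -> exists M : R, (0 < M)%R /\
    forall w x, U w -> (Cmod (w - z) < / M)%R -> (norm (Q w x) <= M * norm x)%R.
Proof.
  intros Hz.
  destruct (linear_norm _ HB) as [b [Hb BB]].
  destruct (HQ z Hz) as [Lz _].
  destruct (linear_norm _ Lz) as [m [Hm Bm]].
  exists (Rmax (2 * m) (2 * (m * b)))%R.
  set (M := Rmax _ _).
  assert (Hmb : (0 < m * b)%R) by now apply Rmult_lt_0_compat.
  assert (H1 : (2 * m <= M)%R) by apply Rmax_l.
  assert (H2 : (2 * (m * b) <= M)%R) by apply Rmax_r.
  split; [lra|].
  intros w x Hw Hd.
  assert (Hid := resolvent_identity z w x Hz Hw).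
  assert (E : Q w x = plus (Q z x) (scal (V := X) (z - w) (Q z (B (Q w x))))).
  { rewrite Hid at 1; module_ring. }
  assert (N : (norm (Q w x) <= m * norm x + Cmod (z - w) * (m * (b * norm (Q w x))))%R).
  { rewrite E at 1.
    eapply Rle_trans; [apply norm_triangle|].
    apply Rplus_le_compat; [apply Bm|].
    eapply Rle_trans; [apply norm_scal_C|].
    apply Rmult_le_compat_l; [apply Cmod_ge_0|].
    eapply Rle_trans; [apply Bm|].
    apply Rmult_le_compat_l; [lra|]; apply BB. }
  rewrite <- Cmod_opp in N; replace (- (z - w)) with (w - z) in N by ring.
  assert (Hn := norm_ge_0 (Q w x)).
  assert (Hx := norm_ge_0 x).
  assert (D : (Cmod (w - z) * (m * b) <= / 2)%R).
  { apply Rle_trans with (/ M * (M / 2))%R.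
    - apply Rmult_le_compat; try lra; apply Cmod_ge_0.
    - right; field; lra. }
  assert (D' : (Cmod (w - z) * (m * (b * norm (Q w x))) <= / 2 * norm (Q w x))%R).
  { replace (Cmod (w - z) * (m * (b * norm (Q w x))))%R
      with (Cmod (w - z) * (m * b) * norm (Q w x))%R by ring.
    now apply Rmult_le_compat_r. }
  apply Rle_trans with (2 * m * norm x)%R; [lra|].
  now apply Rmult_le_compat_r.
Qed.

(** Invertibility on a neighbourhood being given, the resolvent identity alone
    yields the derivative. *)
Lemma inverse_family_derive (z : C) (y : X) :
  locally z U ->
  is_derive (K := C_AbsRing) (fun w => Q w y) z (opp (Q z (B (Q z y)))).
Proof.
  intros HU.
  assert (Hz := locally_singleton _ _ HU).
  destruct (linear_norm _ HB) as [b [Hb BB]].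
  destruct (inverse_family_locally_bounded z Hz) as [M [HM BM]].
  apply is_derive_of_quadratic_bound with (K := (M * (b * (M * (b * (M * norm y)))))%R).
  apply locally_Cmod in HU; destruct HU as [d [Hd HU]].
  apply locally_Cmod; exists (Rmin d (/ M)); split.
  - apply Rmin_pos; [easy|now apply Rinv_0_lt_compat].
  - intros w Hw.
    assert (Hw1 := Rlt_le_trans _ _ _ Hw (Rmin_l _ _)).
    assert (Hw2 := Rlt_le_trans _ _ _ Hw (Rmin_r _ _)).
    apply inverse_family_quadratic; auto; try lra.
    intros x; apply BM; [easy|].
    replace (z - z) with (RtoC 0) by ring; rewrite Cmod_0.
    now apply Rinv_0_lt_compat.
Qed.

End Inverses.

Section Neumann.

Context {X : CompleteNormedModule C_AbsRing}.

(** The preimage of [y] is the Neumann series [sum A^n y]; this is where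
    completeness enters. *)
Lemma invertible_id_minus_contraction (A : X -> X) (q : R) :
  is_linear A -> (0 <= q < 1)%R -> (forall x, norm (A x) <= q * norm x)%R ->
  invertible (fun x => minus x (A x)).
Proof.
  intros HA Hq Bq.
  apply (invertible_of_bounded_below _ (1 - q)%R).
  - apply (is_linear_minus (fun x => x) A); [apply is_linear_id|easy].
  - lra.
  - intros x.
    assert (H : (norm x <= norm (minus x (A x)) + norm (A x))%R).
    { replace x with (plus (minus x (A x)) (A x)) at 1 by module_ring.
      apply norm_triangle. }
    generalize (Bq x); lra.
  - intros y.
    set (u := fun n => Nat.iter n A y).
    assert (Hu : forall n, (norm (u n) <= norm y * q ^ n)%R).
    { induction n as [|n IH]; simpl; [lra|].
      eapply Rle_trans; [apply Bq|].
      apply Rle_trans with (q * (norm y * q ^ n))%R; [|right; ring].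
      now apply Rmult_le_compat_l. }
    assert (Hex : ex_series u).
    { apply (ex_series_le u (fun n => norm y * q ^ n)%R); [exact Hu|].
      apply (ex_series_scal (K := R_AbsRing) (V := R_NormedModule)
               (norm y) (fun n => q ^ n)%R).
      apply ex_series_geom; rewrite Rabs_pos_eq; lra. }
    destruct Hex as [x Hx]; exists x.
    (* [A] maps the series to its own tail, so [A x = x - y] for the sum [x]. *)
    assert (HA' : is_series (fun n => u (S n)) (A x)).
    { unfold is_series in *.
      apply filterlim_ext with (fun n => A (sum_n u n)).
      - induction x0 as [|n IH]; [now rewrite !sum_O|].
        now rewrite !sum_Sn, <- IH, (linear_plus _ HA).
      - eapply filterlim_comp; [exact Hx|]. apply (linear_cont (V := X) A x HA). }
    assert (Hy : is_series (fun n => u (S n)) (plus x (opp (u 0%nat)))).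
    { apply is_series_incr_1.
      replace (plus (plus x (opp (u 0%nat))) (u 0%nat)) with x by module_ring.
      exact Hx. }
    assert (E : A x = plus x (opp (u 0%nat))).
    { exact (filterlim_locally_unique (V := X) (sum_n (fun n => u (S n))) _ _ HA' Hy). }
    rewrite E; change (u 0%nat) with y. module_ring.
Qed.

Lemma invertible_near_identity (A : X -> X) :
  is_linear A ->
  exists d : R, (0 < d)%R /\
    forall z : C, (Cmod z < d)%R -> invertible (fun x => minus x (scal (V := X) z (A x))).
Proof.
  intros HA; destruct (linear_norm _ HA) as [M [HM BM]].
  exists (/ M)%R; split; [now apply Rinv_0_lt_compat|].
  intros z Hz.
  apply (invertible_id_minus_contraction (fun x => scal (V := X) z (A x)) (Cmod z * M)%R).
  - exact (is_linear_scaled (X := X) z A HA).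
  - split; [apply Rmult_le_pos; [apply Cmod_ge_0|lra]|].
    replace 1%R with (/ M * M)%R by (field; lra).
    now apply Rmult_lt_compat_r.
  - intros x; rewrite Rmult_assoc.
    eapply Rle_trans; [apply (norm_scal_C (X := X))|].
    apply Rmult_le_compat_l; [apply Cmod_ge_0|apply BM].
Qed.

End Neumann.

(** * Averages over roots of unity *)

(** For [s = PI / N], the number [exp (2 i s)] is a root of unity of order [N] at
    distance [2 sin s] from [1]. *)
Lemma root_of_unity_near_1 (eta : R) :
  (0 < eta)%R ->
  exists (n : nat) (w : C),
    w ^ S n = 1 /\ w <> 1 /\ Cmod w = 1%R /\ (Cmod (w - 1) < eta)%R.
Proof.
  intros Heta.
  destruct (INR_unbounded (2 * PI / eta)) as [n Hn].
  assert (HPI := PI_RGT_0).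
  (* The order is [n + 2], which keeps [s < PI] and thus the root distinct from 1. *)
  set (m := S n).
  set (s := (PI / INR (S m))%R).
  assert (Hm : (2 <= INR (S m))%R).
  { unfold m; rewrite !S_INR; generalize (pos_INR n); lra. }
  assert (Hs : (0 < s)%R) by (apply Rdiv_lt_0_compat; lra).
  assert (Hs1 : (s < PI)%R).
  { apply (Rmult_lt_reg_r (INR (S m))); [lra|].
    replace (s * INR (S m))%R with PI by (unfold s; field; lra).
    apply Rlt_le_trans with (PI * 2)%R; [lra|apply Rmult_le_compat_l; lra]. }
  assert (Hs2 : (2 * s < eta)%R).
  { apply (Rmult_lt_reg_r (INR (S m) / eta)).
    - apply Rdiv_lt_0_compat; lra.
    - replace (2 * s * (INR (S m) / eta))%R with (2 * PI / eta)%R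
        by (unfold s; field; lra).
      replace (eta * (INR (S m) / eta))%R with (INR (S m)) by (field; lra).
      apply Rlt_trans with (INR n); [lra|].
      unfold m; rewrite !S_INR; lra. }
  assert (Hsin : (0 < sin s)%R) by now apply sin_gt_0.
  assert (Hcos : (cos (2 * s) = 1 - 2 * sin s * sin s)%R) by apply cos_2a_sin.
  assert (Hpow : forall k, (cos (2 * s), sin (2 * s)) ^ k
                           = (cos (INR k * (2 * s)), sin (INR k * (2 * s)))%R).
  { induction k as [|k IH].
    - simpl; rewrite Rmult_0_l, cos_0, sin_0; reflexivity.
    - rewrite Cpow_S, IH, S_INR, Rmult_plus_distr_r, Rmult_1_l, Rplus_comm,
        cos_plus, sin_plus.
      unfold Cmult; simpl; f_equal; ring. }
  exists m, (cos (2 * s), sin (2 * s))%R; repeat split.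
  - rewrite Hpow.
    replace (INR (S m) * (2 * s))%R with (2 * PI)%R by (unfold s; field; lra).
    now rewrite cos_2PI, sin_2PI.
  - intros E; apply (f_equal Re) in E; simpl in E.
    assert (0 < sin s * sin s)%R by now apply Rmult_lt_0_compat.
    lra.
  - unfold Cmod; simpl.
    apply (fun H => eq_trans (f_equal sqrt H) sqrt_1).
    generalize (sin2_cos2 (2 * s)); unfold Rsqr; lra.
  - apply Rle_lt_trans with (2 * sin s)%R; [right|].
    + unfold Cmod; simpl.
      rewrite <- (sqrt_Rsqr (2 * sin s)) by lra; f_equal.
      generalize (sin2_cos2 (2 * s)); unfold Rsqr; rewrite Hcos; lra.
    + generalize (sin_lt_x s Hs); lra.
Qed.

Section Averages.

Context {X : NormedModule C_AbsRing}.

Lemma norm_sum_le (f : nat -> X) (n : nat) (b : R) :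
  (forall k, norm (f k) <= b)%R -> (norm (sum_n f n) <= INR (S n) * b)%R.
Proof.
  intros H; induction n as [|n IH].
  - rewrite sum_O; simpl; rewrite Rmult_1_l; apply H.
  - rewrite sum_Sn, S_INR.
    eapply Rle_trans; [apply norm_triangle|].
    generalize (H (S n)); lra.
Qed.

Lemma sum_telescope (h : nat -> X) (n : nat) :
  sum_n (G := NormedModule.AbelianMonoid _ X) (fun k => minus (h (S k)) (h k)) n
  = minus (h (S n)) (h 0%nat).
Proof.
  induction n as [|n IH]; [now rewrite sum_O|].
  rewrite sum_Sn, IH; module_ring.
Qed.

Lemma sum_n_lin (f g : nat -> X) (a b : C) (n : nat) :
  sum_n (fun k => plus (scal (V := X) a (f k)) (scal (V := X) b (g k))) n
  = plus (scal (V := X) a (sum_n f n)) (scal (V := X) b (sum_n g n)).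
Proof.
  induction n as [|n IH]; [now rewrite !sum_O|].
  rewrite !sum_Sn, IH; module_ring.
Qed.

Lemma sum_minus (f g : nat -> X) (n : nat) :
  sum_n (G := NormedModule.AbelianMonoid _ X) (fun k => minus (f k) (g k)) n
  = minus (sum_n f n) (sum_n g n).
Proof.
  induction n as [|n IH]; [now rewrite !sum_O|].
  rewrite !sum_Sn, IH; module_ring.
Qed.

Lemma norm_sum_const (c : X) (n : nat) :
  (INR (S n) * norm c <= norm (sum_n (fun _ => c) n))%R.
Proof.
  set (t := RtoC (INR (S n))).
  assert (Hn : (0 < INR (S n))%R) by apply lt_0_INR, Nat.lt_0_succ.
  assert (Ht : t <> 0).
  { intros E; apply RtoC_inj in E; lra. }
  assert (E : sum_n (fun _ => c) n = scal (V := X) t c).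
  { unfold t; clear; induction n as [|n IH].
    - rewrite sum_O; simpl; module_ring.
    - rewrite sum_Sn, IH, (S_INR (S n)), RtoC_plus; module_ring. }
  rewrite E.
  assert (Ec : c = scal (V := X) (/ t) (scal (V := X) t c)).
  { module_field; auto. }
  rewrite Ec at 1.
  apply Rle_trans with (INR (S n) * (Cmod (/ t) * norm (scal (V := X) t c)))%R.
  - apply Rmult_le_compat_l; [lra|apply norm_scal_C].
  - right; rewrite Cmod_inv by easy.
    unfold t at 1; rewrite Cmod_R, Rabs_pos_eq by lra.
    field; lra.
Qed.

Definition circle_sum (G : C -> X) (w : C) (n : nat) (r : R) : X :=
  sum_n (fun k => G (r * w ^ k)) n.

(* [D] plays the derivative of [G]; the Taylor estimate holds uniformly on the
   annulus [a <= |z| <= b]. *)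
Context (G D : C -> X) (K a b : R).
Context (Ha : (0 < a)%R) (HK : (0 <= K)%R).
Context (HG : forall w z, (a <= Cmod w <= b)%R -> (a <= Cmod z <= b)%R ->
  (norm (minus (minus (G w) (G z)) (scal (V := X) (w - z)%C (D z)))
   <= K * (Cmod (w - z) * Cmod (w - z)))%R).

(** For [z = r u] with [u = w^k], the radial increment of [G] is [delta u D(z)] to
    first order, and the increment from [z] to [w z] is [(w - 1) r u D(z)].  Their
    ratio [c] does not depend on [k], and the increments from [z] to [w z] sum to
    zero over the circle; only the quadratic errors remain. *)
Lemma circle_sum_step (w : C) (n : nat) (r delta : R) :
  w ^ S n = 1 -> w <> 1 -> Cmod w = 1%R ->
  (a <= r)%R -> (0 <= delta)%R -> (r + delta <= b)%R ->
  (norm (minus (circle_sum G w n (r + delta)) (circle_sum G w n r))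
   <= INR (S n) * (K * (delta * (delta + Cmod (w - 1) * b))))%R.
Proof.
  intros Hw Hw1 Hmod Hr Hd Hrb.
  assert (Hw1' : w - 1 <> 0).
  { intros E; apply Hw1; replace w with (w - 1 + 1) by ring; rewrite E; ring. }
  assert (Hpw : (0 < Cmod (w - 1))%R) by now apply Cmod_gt_0.
  assert (Hr0 : RtoC r <> 0).
  { intros E; apply RtoC_inj in E; lra. }
  set (c := RtoC delta / ((w - 1) * r)).
  set (e := fun k =>
    plus (scal (V := X) (RtoC 1) (minus (G ((r + delta)%R * w ^ k)) (G (r * w ^ k))))
         (scal (V := X) (- c) (minus (G (r * w ^ S k)) (G (r * w ^ k))))).
  assert (E : minus (circle_sum G w n (r + delta)) (circle_sum G w n r) = sum_n e n).
  { unfold e.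
    rewrite (sum_n_lin (fun k => minus (G ((r + delta)%R * w ^ k)) (G (r * w ^ k)))
               (fun k => minus (G (r * w ^ S k)) (G (r * w ^ k)))).
    rewrite (sum_telescope (fun k => G (r * w ^ k)) n).
    rewrite (sum_minus (fun k => G ((r + delta)%R * w ^ k)) (fun k => G (r * w ^ k))).
    rewrite Hw; simpl (w ^ 0); unfold circle_sum; module_ring. }
  rewrite E; apply norm_sum_le; intros k.
  assert (Hu : Cmod (w ^ k) = 1%R) by (rewrite Cmod_pow, Hmod; apply pow1).
  set (u := w ^ k) in *.
  assert (E1 : e k = plus
     (minus (minus (G ((r + delta)%R * u)) (G (r * u)))
            (scal (V := X) ((r + delta)%R * u - r * u) (D (r * u))))
     (scal (V := X) (- c)
        (minus (minus (G (r * (w * u))) (G (r * u)))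
               (scal (V := X) (r * (w * u) - r * u) (D (r * u)))))).
  { unfold e; rewrite Cpow_S; fold u.
    module_coeffs; try ring.
    unfold c; rewrite RtoC_plus; field; auto. }
  rewrite E1.
  assert (M1 : Cmod (r * u) = r).
  { rewrite Cmod_mult, Hu, Cmod_R, Rabs_pos_eq; lra. }
  assert (M2 : Cmod ((r + delta)%R * u) = (r + delta)%R).
  { rewrite Cmod_mult, Hu, Cmod_R, Rabs_pos_eq; lra. }
  assert (M3 : Cmod (r * (w * u)) = r).
  { rewrite !Cmod_mult, Hu, Hmod, Cmod_R, Rabs_pos_eq; lra. }
  assert (M4 : Cmod ((r + delta)%R * u - r * u) = delta).
  { replace ((r + delta)%R * u - r * u) with (delta * u) by (rewrite RtoC_plus; ring).
    rewrite Cmod_mult, Hu, Cmod_R, Rabs_pos_eq; lra. }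
  assert (M5 : Cmod (r * (w * u) - r * u) = (r * Cmod (w - 1))%R).
  { replace (r * (w * u) - r * u) with (r * (w - 1) * u) by ring.
    rewrite !Cmod_mult, Hu, Cmod_R, Rabs_pos_eq; lra. }
  assert (M6 : Cmod (- c) = (delta / (Cmod (w - 1) * r))%R).
  { unfold c; rewrite Cmod_opp, Cmod_div by now apply Cmult_neq_0.
    rewrite Cmod_mult, !Cmod_R, !Rabs_pos_eq; lra. }
  eapply Rle_trans; [apply norm_triangle|].
  apply Rle_trans with
    (K * (delta * delta)
     + delta / (Cmod (w - 1) * r) * (K * ((r * Cmod (w - 1)) * (r * Cmod (w - 1)))))%R.
  - apply Rplus_le_compat.
    + eapply Rle_trans; [apply HG|rewrite M4; lra].
      * rewrite M2; lra.
      * rewrite M1; lra.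
    + eapply Rle_trans; [apply norm_scal_C|].
      rewrite M6; apply Rmult_le_compat_l.
      * apply Rmult_le_pos; [easy|].
        left; apply Rinv_0_lt_compat, Rmult_lt_0_compat; lra.
      * eapply Rle_trans; [apply HG|rewrite M5; lra].
        -- rewrite M3; lra.
        -- rewrite M1; lra.
  - replace (delta / (Cmod (w - 1) * r) * (K * ((r * Cmod (w - 1)) * (r * Cmod (w - 1)))))%R
      with (K * (delta * (Cmod (w - 1) * r)))%R by (field; lra).
    rewrite <- Rmult_plus_distr_l, <- Rmult_plus_distr_l.
    apply Rmult_le_compat_l; [easy|].
    apply Rmult_le_compat_l; [easy|].
    apply Rplus_le_compat_l, Rmult_le_compat_l; lra.
Qed.

Lemma circle_sum_walk (w : C) (n : nat) (delta : R) (j : nat) :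
  w ^ S n = 1 -> w <> 1 -> Cmod w = 1%R ->
  (0 <= delta)%R -> (a + INR j * delta <= b)%R ->
  (norm (minus (circle_sum G w n (a + INR j * delta)) (circle_sum G w n a))
   <= INR j * (INR (S n) * (K * (delta * (delta + Cmod (w - 1) * b)))))%R.
Proof.
  intros Hw Hw1 Hmod Hd.
  induction j as [|j IH]; intros Hj.
  - change (INR 0) with 0%R; rewrite !Rmult_0_l, Rplus_0_r.
    replace (minus (circle_sum G w n a) (circle_sum G w n a)) with (zero : X) by module_ring.
    right; exact norm_zero.
  - rewrite S_INR in Hj |- *.
    assert (0 <= INR j * delta)%R by (apply Rmult_le_pos; [apply pos_INR|easy]).
    replace (a + (INR j + 1) * delta)%R with (a + INR j * delta + delta)%R in * by ring.
    set (r := (a + INR j * delta)%R) in *.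
    replace (minus _ _) with
      (plus (minus (circle_sum G w n (r + delta)) (circle_sum G w n r))
            (minus (circle_sum G w n r) (circle_sum G w n a))) by module_ring.
    eapply Rle_trans; [apply norm_triangle|].
    rewrite Rmult_plus_distr_r, Rmult_1_l, Rplus_comm.
    apply Rplus_le_compat; [apply IH; lra|].
    apply circle_sum_step; auto; unfold r; lra.
Qed.

(** If [G] is within [eps] of [c] on the inner circle and within [eps] of [0] on
    the outer one, the near-equality of the two means bounds [c].  The walk from
    radius [a] to radius [b] in steps of length [delta] costs at most
    [K (b - a) (delta + |w - 1| b)], and both [delta] and [|w - 1|] are free. *)
Lemma circle_means_agree (c : X) (eps : R) :
  (a <= b)%R ->
  (forall z, Cmod z = a -> norm (minus (G z) c) <= eps)%R ->
  (forall z, Cmod z = b -> norm (G z) <= eps)%R ->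
  (norm c <= 2 * eps)%R.
Proof.
  intros Hab Hina Houtb.
  apply le_epsilon; intros eta Heta.
  (* [L] bounds [K (b - a)] and, unlike it, can be divided by. *)
  set (L := (K * (b - a) + 1)%R).
  assert (HKab : (0 <= K * (b - a))%R) by (apply Rmult_le_pos; lra).
  assert (HL : (0 < L)%R) by (unfold L; lra).
  destruct (root_of_unity_near_1 (eta / (2 * L * b))) as (n & w & Hw & Hw1 & Hmod & Hsmall).
  { apply Rdiv_lt_0_compat; [lra|]. repeat apply Rmult_lt_0_compat; lra. }
  destruct (INR_unbounded ((b - a) * (2 * L) / eta)) as [m Hm].
  set (N := INR (S m)).
  set (delta := ((b - a) / N)%R).
  assert (HN : (INR m < N)%R) by (unfold N; rewrite S_INR; lra).
  assert (HN0 : (0 < N)%R) by (generalize (pos_INR m); lra).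
  assert (Hd0 : (0 <= delta)%R).
  { unfold delta; apply Rmult_le_pos; [lra|]; left; now apply Rinv_0_lt_compat. }
  assert (Hd1 : (delta <= eta / (2 * L))%R).
  { apply (Rmult_le_reg_r (N * (2 * L) / eta)).
    - apply Rdiv_lt_0_compat; [|lra]. apply Rmult_lt_0_compat; lra.
    - unfold delta.
      replace ((b - a) / N * (N * (2 * L) / eta))%R
        with ((b - a) * (2 * L) / eta)%R by (field; lra).
      replace (eta / (2 * L) * (N * (2 * L) / eta))%R with N by (field; lra).
      lra. }
  assert (Hend : (a + N * delta = b)%R) by (unfold delta; field; lra).
  assert (Hwalk := circle_sum_walk w n delta (S m) Hw Hw1 Hmod Hd0).
  fold N in Hwalk; rewrite Hend in Hwalk.
  specialize (Hwalk (Rle_refl b)).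
  assert (Hpow : forall k, Cmod (w ^ k) = 1%R)
    by (intros k; rewrite Cmod_pow, Hmod; apply pow1).
  assert (Sa : (norm (sum_n (fun k => minus (G (a * w ^ k)) c) n) <= INR (S n) * eps)%R).
  { apply norm_sum_le; intros k; apply Hina.
    rewrite Cmod_mult, Hpow, Cmod_R, Rabs_pos_eq; lra. }
  assert (Sb : (norm (circle_sum G w n b) <= INR (S n) * eps)%R).
  { apply norm_sum_le; intros k; apply Houtb.
    rewrite Cmod_mult, Hpow, Cmod_R, Rabs_pos_eq; lra. }
  assert (Hn : (0 < INR (S n))%R) by apply lt_0_INR, Nat.lt_0_succ.
  apply (Rmult_le_reg_l (INR (S n))); [easy|].
  eapply Rle_trans; [apply norm_sum_const|].
  assert (E : sum_n (fun _ => c) n =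
    plus (opp (sum_n (fun k => minus (G (a * w ^ k)) c) n))
      (plus (opp (minus (circle_sum G w n b) (circle_sum G w n a)))
            (circle_sum G w n b))).
  { assert (Em : sum_n (fun k => minus (G (a * w ^ k)) c) n
      = minus (circle_sum G w n a) (sum_n (fun _ => c) n)).
    { exact (sum_minus (fun k => G (a * w ^ k)) (fun _ => c) n). }
    rewrite Em; module_ring. }
  rewrite E.
  eapply Rle_trans; [apply norm_triangle|].
  rewrite norm_opp.
  eapply Rle_trans; [apply Rplus_le_compat_l, norm_triangle|].
  rewrite norm_opp.
  assert (Hfin : (N * (INR (S n) * (K * (delta * (delta + Cmod (w - 1) * b))))
                  <= INR (S n) * eta)%R).
  { replace (N * (INR (S n) * (K * (delta * (delta + Cmod (w - 1) * b)))))%R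
      with (INR (S n) * (K * (b - a) * (delta + Cmod (w - 1) * b)))%R
      by (unfold delta; field; lra).
    apply Rmult_le_compat_l; [lra|].
    assert (H2 : (Cmod (w - 1) * b <= eta / (2 * L))%R).
    { apply Rle_trans with (eta / (2 * L * b) * b)%R.
      - apply Rmult_le_compat_r; lra.
      - right; field; lra. }
    apply Rle_trans with (L * (eta / (2 * L) + eta / (2 * L)))%R.
    - apply Rmult_le_compat; try lra.
      + assert (0 <= Cmod (w - 1) * b)%R by (apply Rmult_le_pos; [apply Cmod_ge_0|lra]).
        lra.
      + unfold L; lra.
    - right; field; lra. }
  lra.
Qed.

End Averages.

(** * Quasinilpotent operators *)

Section Liouville.

Context {X : NormedModule C_AbsRing}.

(** Compactness of the square [-b <= Re z, Im z <= b]: at each of its points the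
    gauge [d] is chosen so that [1/d] bounds the inverses at the nearby points of
    the annulus, hence a lower bound for the gauge is a bound on the annulus.  Near
    the origin the inverses may blow up, and there the gauge is small enough to
    stay away from the annulus. *)
Lemma inverse_family_annulus_bound (B : X -> X) (F Q : C -> X -> X) (a b : R) :
  is_linear B -> affine_family B F -> inverse_family (fun z => z <> 0) F Q ->
  (0 < a)%R ->
  exists M : R, (0 < M)%R /\
    forall z x, (a <= Cmod z <= b)%R -> (norm (Q z x) <= M * norm x)%R.
Proof.
  intros HB HF HQ Ha.
  assert (Hloc : forall p : R * R, exists d : posreal, forall q : C,
     (Rabs (fst q - fst p) < d)%R -> (Rabs (snd q - snd p) < d)%R ->
     (a <= Cmod q)%R -> forall x, (norm (Q q x) <= / d * norm x)%R).
  { intros p.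
    assert (Hmax : forall (d : R) (q : C), (Rabs (fst q - fst p) < d)%R ->
      (Rabs (snd q - snd p) < d)%R -> (Cmod (q - p) < 2 * d)%R).
    { intros d q H1 H2.
      eapply Rle_lt_trans; [apply Cmod_2Rmax|].
      assert (Hs : (sqrt 2 < 2)%R).
      { rewrite <- (sqrt_Rsqr 2) at 2 by lra; apply sqrt_lt_1; unfold Rsqr; lra. }
      set (m := Rmax _ _).
      assert (Hm : (m < d)%R) by now apply Rmax_lub_lt.
      assert (Hm0 : (0 <= m)%R)
        by (eapply Rle_trans; [apply Rabs_pos|apply Rmax_l]).
      assert (Hs0 := sqrt_pos 2).
      apply Rle_lt_trans with (2 * m)%R; [|lra].
      apply Rmult_le_compat_r; lra. }
    destruct (classic ((p : C) = 0)) as [Hp|Hp].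
    (* A point within [a/2] of the origin in both coordinates has modulus less
       than [a]. *)
    - assert (Ha2 : (0 < a / 2)%R) by lra.
      exists (mkposreal _ Ha2); simpl; intros q H1 H2 H3.
      exfalso; generalize (Hmax (a / 2)%R q H1 H2); rewrite Hp.
      replace (q - 0) with q by ring; lra.
    - destruct (inverse_family_locally_bounded (fun z => z <> 0) B F Q HB HF HQ p Hp)
        as [M [HM BM]].
      assert (HM2 : (0 < / (2 * M))%R) by (apply Rinv_0_lt_compat; lra).
      exists (mkposreal _ HM2); simpl; intros q H1 H2 H3 x.
      rewrite Rinv_inv.
      apply Rle_trans with (M * norm x)%R.
      + apply BM; [apply Cmod_gt_0; lra|].
        replace (/ M)%R with (2 * / (2 * M))%R by (field; lra).
        now apply Hmax.
      + apply Rmult_le_compat_r; [apply norm_ge_0|lra]. }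
  destruct (choice _ Hloc) as [del Hdel].
  destruct (compactness_value_2d (-b) b (-b) b (fun u v => del (u, v))) as [d Hd].
  exists (/ d)%R; split; [apply Rinv_0_lt_compat, cond_pos|].
  intros z x [Hz1 Hz2].
  assert (Hre : forall t : R, (Rabs t <= Cmod z)%R -> (- b <= t <= b)%R).
  { intros t Ht; apply Rabs_le_between; lra. }
  assert (Hz := Rmax_Cmod z).
  assert (Hx1 : (- b <= fst z <= b)%R)
    by (apply Hre; eapply Rle_trans; [apply Rmax_l|exact Hz]).
  assert (Hx2 : (- b <= snd z <= b)%R)
    by (apply Hre; eapply Rle_trans; [apply Rmax_r|exact Hz]).
  destruct (NNPP _ (Hd _ _ Hx1 Hx2)) as (u & v & _ & _ & Hu & Hv & Hdd).
  eapply Rle_trans; [apply (Hdel (u, v) z); auto|].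
  apply Rmult_le_compat_r; [apply norm_ge_0|].
  apply Rinv_le_contravar; [apply cond_pos|easy].
Qed.

Lemma affine_family_shift (A : X -> X) : affine_family (fun x => x) (shift A).
Proof. intros w z x; unfold shift; module_ring. Qed.

(** From [z x = y + A x], [(|z| - |A|) |x| <= |y|]. *)
Lemma resolvent_small_at_infinity (A : X -> X) (y : X) (eps : R) :
  is_linear A -> (0 < eps)%R ->
  exists r : R, (0 < r)%R /\
    forall (z : C) (x : X), (r <= Cmod z)%R -> shift A z x = y -> (norm x <= eps)%R.
Proof.
  intros HA Heps; destruct (linear_norm _ HA) as [M [HM BM]].
  assert (Hy := norm_ge_0 y).
  assert (Hye : (0 <= norm y / eps)%R).
  { apply Rmult_le_pos; [easy|]; left; now apply Rinv_0_lt_compat. }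
  exists (M + norm y / eps + 1)%R; split; [lra|].
  intros z x Hz Hx.
  assert (Hz0 : z <> 0) by (apply Cmod_gt_0; lra).
  assert (E : x = scal (V := X) (/ z) (plus y (A x))).
  { rewrite <- Hx; unfold shift; module_field; auto. }
  assert (H : (Cmod z * norm x <= norm y + M * norm x)%R).
  { rewrite E at 1.
    apply Rle_trans with (Cmod z * (Cmod (/ z) * norm (plus y (A x))))%R.
    - apply Rmult_le_compat_l; [apply Cmod_ge_0|apply norm_scal_C].
    - rewrite Cmod_inv, <- Rmult_assoc, Rinv_r, Rmult_1_l by (auto; lra).
      eapply Rle_trans; [apply norm_triangle|].
      apply Rplus_le_compat_l, BM. }
  apply Rnot_lt_le; intros Hlt.
  assert (H1 : ((norm y / eps + 1) * norm x <= norm y)%R).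
  { apply Rle_trans with ((Cmod z - M) * norm x)%R; [|lra].
    apply Rmult_le_compat_r; [apply norm_ge_0|lra]. }
  assert (H2 : (norm y / eps * eps <= norm y / eps * norm x)%R)
    by (apply Rmult_le_compat_l; lra).
  replace (norm y / eps * eps)%R with (norm y) in H2 by (field; lra).
  lra.
Qed.

(** Near [0] and off [0], [g] coincides with the resolvent applied to [y].  The
    circle means of the latter tend to [g 0] at small radii and to [0] at large
    ones, so [g 0 = 0]; the equation at [0] then reads [y = - A (g 0) = 0]. *)
Lemma quasinilpotent_no_local_resolvent_at_0 (A : X -> X) (g : C -> X) (y : X) :
  is_linear A -> (forall z : C, z <> 0 -> invertible (shift A z)) ->
  continuous g (RtoC 0) -> locally (RtoC 0) (fun z => shift A z (g z) = y) ->
  y = zero.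
Proof.
  intros HA Hinv Hcont Hg.
  destruct (ex_inverse_family _ _ Hinv) as [Q HQ].
  assert (HI : is_linear (fun x : X => x)) by apply is_linear_id.
  assert (HF := affine_family_shift A).
  assert (Hg0 : norm (g 0) = 0%R).
  { apply Rle_antisym; [|apply norm_ge_0].
    apply le_epsilon; intros eta Heta.
    set (eps := (eta / 2)%R).
    assert (Heps : (0 < eps)%R) by (unfold eps; lra).
    assert (Hnear : locally (RtoC 0) (fun z => (norm (minus (g z) (g 0)) < eps)%R)).
    { exact (Hcont _ (locally_ball_norm (g 0) (mkposreal eps Heps))). }
    destruct (proj1 (locally_Cmod _ _) (filter_and _ _ Hg Hnear)) as [d [Hd Hdg]].
    set (a := (d / 2)%R).
    assert (Ha : (0 < a)%R) by (unfold a; lra).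
    destruct (resolvent_small_at_infinity A y eps HA Heps) as [r [Hr Hfar]].
    set (b := Rmax a r).
    assert (Hab : (a <= b)%R) by apply Rmax_l.
    destruct (inverse_family_annulus_bound _ _ Q a b HI HF HQ Ha) as [M [HM BM]].
    replace (0 + eta)%R with (2 * eps)%R by (unfold eps; lra).
    apply (circle_means_agree (fun z => Q z y) (fun z => opp (Q z (Q z y)))
             (M * (1 * (M * (1 * (M * norm y)))))%R a b Ha).
    - repeat apply Rmult_le_pos; try lra; apply norm_ge_0.
    - intros w z Hw Hz.
      apply (inverse_family_quadratic (fun z => z <> 0) (fun x => x) (shift A) Q HF HQ);
        try lra.
      + apply Cmod_gt_0; lra.
      + apply Cmod_gt_0; lra.
      + intros x; now apply BM.
      + intros x; now apply BM.
      + intros x; lra.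
    - easy.
    - intros z Hz.
      assert (Hz0 : z <> 0) by (apply Cmod_gt_0; lra).
      destruct (Hdg z) as [E1 E2].
      { replace (z - 0) with z by ring; unfold a in Hz; lra. }
      rewrite <- E1, (proj1 (proj2 (HQ z Hz0))).
      now left.
    - intros z Hz.
      assert (Hz0 : z <> 0) by (apply Cmod_gt_0; lra).
      apply (Hfar z); [rewrite Hz; apply Rmax_r|].
      apply (HQ z Hz0). }
  apply norm_eq_zero in Hg0.
  rewrite <- (locally_singleton _ _ Hg), Hg0.
  unfold shift; rewrite (lin_zero A HA); module_ring.
Qed.

End Liouville.

(** * Local spectra of an operator and its Drazin inverse *)

Lemma continuous_of_ex_derive {X : NormedModule C_AbsRing} (f : C -> X) (z : C) :
  ex_derive (K := C_AbsRing) f z -> continuous (T := C_UniformSpace) f z.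
Proof.
  intros H P HP; apply (locally_C z).
  exact (ex_derive_continuous f z H P HP).
Qed.

Lemma Cinv_neq_0 (z : C) : z <> 0 -> / z <> 0.
Proof.
  intros Hz E; apply Hz; replace z with (z * z * / z) by (field; auto).
  rewrite E; ring.
Qed.

Lemma locally_neq_0 (z : C) : z <> 0 -> locally z (fun w : C => w <> 0).
Proof.
  intros Hz; apply locally_Cmod; exists (Cmod z); split; [now apply Cmod_gt_0|].
  intros w Hw E; rewrite E in Hw.
  replace (0 - z) with (- z) in Hw by ring; rewrite Cmod_opp in Hw; lra.
Qed.

Lemma locally_Cinv (z : C) (P : C -> Prop) :
  z <> 0 -> locally (/ z) P -> locally z (fun w : C => w <> 0 /\ P (/ w)).
Proof.
  intros Hz HP; apply filter_and.
  - now apply locally_neq_0.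
  - apply locally_C.
    apply (ex_derive_continuous (V := AbsRing_NormedModule C_AbsRing) Cinv z
             (ex_derive_Cinv z Hz)).
    now apply (locally_C (/ z)).
Qed.

Lemma ex_derive_lin {X : NormedModule C_AbsRing} (A : X -> X) (f : C -> X) (z : C) :
  is_linear A -> ex_derive (K := C_AbsRing) f z ->
  ex_derive (K := C_AbsRing) (fun w => A (f w)) z.
Proof.
  intros HA Hf; apply ex_derive_filterdiff in Hf; apply ex_derive_filterdiff.
  apply (ex_filterdiff_comp' (U := AbsRing_NormedModule C_AbsRing) f A z); [exact Hf|].
  now apply ex_filterdiff_linear.
Qed.

(** The part of the relation between [T] and its generalized Drazin inverse that is
    symmetric: both are inverse to each other on the range of the projection [P]
    and have no nonzero spectrum on its kernel. *)
Record drazin_pair {X : NormedModule C_AbsRing} (T S P : X -> X) : Prop := {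
  dp_lin : is_linear T;
  dp_lin' : is_linear S;
  dp_proj_lin : is_linear P;
  dp_proj : forall x, P (P x) = P x;
  dp_comm : forall x, P (T x) = T (P x);
  dp_comm' : forall x, P (S x) = S (P x);
  dp_inv : forall x, T (S (P x)) = P x;
  dp_inv' : forall x, S (T (P x)) = P x;
  dp_nil : forall z : C, z <> 0 -> invertible (shift (fun x => T (minus x (P x))) z);
  dp_nil' : forall z : C, z <> 0 -> invertible (shift (fun x => S (minus x (P x))) z)
}.

Arguments dp_lin {X T S P} _.
Arguments dp_lin' {X T S P} _.
Arguments dp_proj_lin {X T S P} _.
Arguments dp_proj {X T S P} _.
Arguments dp_comm {X T S P} _.
Arguments dp_comm' {X T S P} _.
Arguments dp_inv {X T S P} _.
Arguments dp_inv' {X T S P} _.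
Arguments dp_nil {X T S P} _.
Arguments dp_nil' {X T S P} _.

Section Local_spectra.

Context {X : NormedModule C_AbsRing}.

Lemma local_spectral_subspace_iff (T : X -> X) (Omega : C -> Prop) (x : X) :
  local_spectral_subspace T Omega x <->
  forall z : C, ~ Omega z -> local_resolvent_set T x z.
Proof.
  split; intros H z Hz; apply NNPP; intros Hn; auto.
Qed.

Lemma local_resolvent_set_plus (T : X -> X) (x y : X) (z : C) :
  is_linear T -> local_resolvent_set T x z -> local_resolvent_set T y z ->
  local_resolvent_set T (plus x y) z.
Proof.
  intros HT (U & HU & Uz & f & Af & Ef) (V & HV & Vz & g & Ag & Eg).
  exists (fun w => U w /\ V w); repeat split; auto.
  - now apply open_and.
  - exists (fun w => plus (f w) (g w)); split.
    + intros w [Hu Hv]; apply (ex_derive_plus (K := C_AbsRing)); auto.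
    + intros w [Hu Hv]; rewrite <- (Ef w Hu), <- (Eg w Hv); unfold shift.
      rewrite (linear_plus _ HT); module_ring.
Qed.

Lemma drazin_pair_sym (T S P : X -> X) : drazin_pair T S P -> drazin_pair S T P.
Proof. now intros []; constructor. Qed.

(** On the kernel of [P = T S], [T] is the opposite of the quasinilpotent operator
    [N = T S T - T], and [S] vanishes because [S T S = S]. *)
Lemma gen_Drazin_inverse_pair (T S : X -> X) :
  is_linear T -> is_gen_Drazin_inverse T S -> drazin_pair T S (fun x => T (S x)).
Proof.
  intros HT (HS & Hcomm & HSTS & N & HN & Hqn & HTST).
  constructor; auto.
  - exact (is_linear_comp S T HS HT).
  - intros x; now rewrite HSTS.
  - intros x; now rewrite Hcomm.
  - intros x; now rewrite HSTS.
  - intros x; now rewrite (Hcomm (T (S x))), HSTS.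
  - intros z Hz.
    assert (Hinv : invertible (shift N (- z))).
    { apply NNPP; intros Hn.
      apply Hz; replace z with (- (- z)) by ring.
      rewrite (proj1 (Hqn (- z)) Hn); ring. }
    assert (E : forall x, shift (fun y => T (minus y (T (S y)))) z x
                          = opp (shift N (- z) x)).
    { intros x; unfold shift.
      rewrite (lin_minus T _ _ HT), <- Hcomm, HTST; module_ring. }
    destruct Hinv as (B & HB & B1 & B2).
    exists (fun x => opp (B x)); split; [|split].
    + apply (is_linear_comp B (opp (G := X)) HB (is_linear_opp)).
    + intros x; rewrite E, (lin_opp B _ HB), B1; module_ring.
    + intros x; rewrite E.
      assert (HL : is_linear (shift N (- z))) by now apply is_linear_shift.
      rewrite (lin_opp _ _ HL), B2; module_ring.
  - intros z Hz.
    exists (fun x => scal (V := X) (/ z) x); split; [|split].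
    + exact (is_linear_scaled (/ z) (fun x => x) is_linear_id).
    + intros x; unfold shift.
      rewrite (lin_minus S _ _ HS), HSTS; module_field; auto.
    + intros x; unfold shift.
      rewrite (lin_minus S _ _ HS), HSTS; module_field; auto.
Qed.

Context (T S P : X -> X).
Context (HD : drazin_pair T S P).

Lemma nil_part_lin : is_linear (fun x => minus x (P x)).
Proof. apply (is_linear_minus (fun x => x) P is_linear_id), (dp_proj_lin HD). Qed.

Lemma nil_part_comm (x : X) : T (minus x (P x)) = minus (T x) (P (T x)).
Proof. now rewrite (lin_minus T _ _ (dp_lin HD)), (dp_comm HD). Qed.

(** Write [E = 1 - P].  As [E] commutes with [T],
    [(z - T) E (z - T E)^-1 x = E (z - T E) (z - T E)^-1 x = E x]. *)
Lemma local_resolvent_nil_part (x : X) (z : C) :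
  z <> 0 -> local_resolvent_set T (minus x (P x)) z.
Proof.
  intros Hz.
  assert (HT := dp_lin HD). assert (HP := dp_proj_lin HD).
  assert (HE := nil_part_lin).
  destruct (ex_inverse_family _ _ (dp_nil HD)) as [Q HQ].
  exists (fun w : C => w <> 0); repeat split; auto.
  - intros w Hw; now apply locally_neq_0.
  - exists (fun w => minus (Q w x) (P (Q w x))); split.
    + intros w Hw.
      apply (ex_derive_lin (fun x => minus x (P x)) (fun w => Q w x) w HE).
      eexists.
      apply (inverse_family_derive (fun w : C => w <> 0) (fun x => x) _ Q
               is_linear_id (affine_family_shift _) HQ).
      now apply locally_neq_0.
    + intros w Hw.
      assert (E := proj2 (proj2 (HQ w Hw)) x).
      unfold shift in E |- *.
      set (v := Q w x) in *; clearbody v.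
      assert (Hv : P (T (minus v (P v))) = zero).
      { rewrite (dp_comm HD), (lin_minus P _ _ HP), (dp_proj HD).
        replace (minus (P v) (P v)) with (zero : X) by module_ring.
        exact (lin_zero T HT). }
      rewrite <- E, (lin_minus P _ _ HP), (linear_scal _ HP), Hv; module_ring.
Qed.

(** The kernel part of a local resolvent of [x] at [0] is one of the kernel part of
    [x] for the quasinilpotent part of [T], so the kernel part of [x] is zero. *)
Lemma proj_of_local_resolvent_0 (x : X) : local_resolvent_set T x 0 -> P x = x.
Proof.
  assert (HT := dp_lin HD). assert (HP := dp_proj_lin HD).
  assert (HE := nil_part_lin).
  intros (U & HU & U0 & f & Af & Ef).
  assert (E : minus x (P x) = zero).
  { apply (quasinilpotent_no_local_resolvent_at_0 (fun y => T (minus y (P y)))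
             (fun w => minus (f w) (P (f w)))).
    - apply (is_linear_comp (fun y => minus y (P y)) T HE HT).
    - exact (dp_nil HD).
    - apply continuous_of_ex_derive.
      apply (ex_derive_lin (fun x => minus x (P x)) f 0 HE); auto.
    - apply (filter_imp U); [|now apply HU].
      intros w Hw; rewrite <- (Ef w Hw); unfold shift.
      set (v := f w).
      assert (Hv : T (minus (minus v (P v)) (P (minus v (P v)))) = minus (T v) (P (T v))).
      { rewrite (lin_minus P _ _ HP), (dp_proj HD), <- nil_part_comm; f_equal; module_ring. }
      rewrite Hv, (lin_minus P _ _ HP), (linear_scal _ HP); module_ring. }
  replace (P x) with (minus x (minus x (P x))) by module_ring.
  rewrite E; module_ring.
Qed.

(** On the range of [P], where [S] inverts [T], with [w = 1/z] one has
    [(w - S)^-1 = z - z^2 (z - T)^-1]. *)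
Lemma local_resolvent_proj_Cinv (x : X) (z : C) :
  z <> 0 -> local_resolvent_set T x z -> local_resolvent_set S (P x) (/ z).
Proof.
  assert (HT := dp_lin HD). assert (HS := dp_lin' HD).
  assert (HP := dp_proj_lin HD).
  intros Hz (U & HU & Uz & g & Ag & Eg).
  assert (Hz' := Cinv_neq_0 z Hz).
  exists (fun w : C => w <> 0 /\ U (/ w)); split; [|split].
  - intros w [Hw Uw]; now apply (locally_Cinv w U Hw), HU.
  - split; [easy|]. now replace (/ / z) with z by (field; auto).
  - exists (fun w => minus (scal (V := X) (/ w) (P x))
                       (scal (V := X) (/ w * / w) (P (g (/ w))))); split.
    + intros w [Hw Uw].
      assert (Dinv := ex_derive_Cinv w Hw).
      assert (Dg : ex_derive (K := C_AbsRing) (fun w => P (g (/ w))) w).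
      { apply ex_derive_lin; [easy|].
        apply (ex_derive_comp (K := C_AbsRing) g Cinv); auto. }
      assert (Dscal : forall h : C -> X, ex_derive (K := C_AbsRing) h w ->
        ex_derive (K := C_AbsRing) (fun w => scal (V := X) (/ w) (h w)) w).
      { intros h Hh; apply ex_derive_filterdiff in Hh, Dinv; apply ex_derive_filterdiff.
        apply (ex_filterdiff_scal_fct (U := AbsRing_NormedModule C_AbsRing) w Cinv
                 h Cmult_comm Dinv Hh). }
      apply (ex_derive_minus (K := C_AbsRing)).
      * apply Dscal, ex_derive_const.
      * apply (ex_derive_ext (K := C_AbsRing)
          (fun w => scal (V := X) (/ w) (scal (V := X) (/ w) (P (g (/ w)))))).
        -- intros v; apply (scal_assoc (V := X)).
        -- auto.
    + intros w [Hw Uw].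
      set (v := P (g (/ w))).
      assert (Ev : minus (scal (V := X) (/ w) (S v)) v = S (P x)).
      { rewrite <- (Eg (/ w) Uw); unfold shift.
        rewrite (lin_minus P _ _ HP), (linear_scal _ HP), (dp_comm HD).
        rewrite (lin_minus S _ _ HS), (linear_scal _ HS), (dp_inv' HD).
        reflexivity. }
      unfold shift.
      rewrite (lin_minus S _ _ HS), !(linear_scal _ HS), <- Ev.
      module_field; auto.
Qed.

(** On the range of [P], where [S] inverts [T], [(z - T)^-1 = - S (1 - z S)^-1]. *)
Lemma local_resolvent_at_0 (x : X) :
  (exists d : R, (0 < d)%R /\ forall z : C, (Cmod z < d)%R ->
     invertible (fun y => minus y (scal (V := X) z (S y)))) ->
  P x = x -> local_resolvent_set T x 0.
Proof.
  assert (HT := dp_lin HD). assert (HS := dp_lin' HD).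
  assert (HP := dp_proj_lin HD).
  intros (d & Hd & Hinv) Hx.
  destruct (ex_inverse_family _ _ Hinv) as [Q HQ].
  assert (Hopen : forall w : C, (Cmod w < d)%R -> locally w (fun v : C => Cmod v < d)%R).
  { intros w Hw; apply locally_Cmod; exists (d - Cmod w)%R; split; [lra|].
    intros v Hv; replace v with (v - w + w) by ring.
    eapply Rle_lt_trans; [apply Cmod_triangle|lra]. }
  assert (HF : affine_family (fun y => opp (S y))
                 (fun z y => minus y (scal (V := X) z (S y)))).
  { intros w z y; module_ring. }
  assert (HB : is_linear (fun y => opp (S y)))
    by exact (is_linear_comp S (opp (G := X)) HS is_linear_opp).
  assert (HSP : is_linear (fun y => opp (S (P y))))
    by exact (is_linear_comp P (fun y => opp (S y)) HP HB).
  exists (fun w : C => Cmod w < d)%R; split; [|split].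
  - exact Hopen.
  - now rewrite Cmod_0.
  - exists (fun w => opp (S (P (Q w x)))); split.
    + intros w Hw; apply (ex_derive_lin (fun y => opp (S (P y))) (fun w => Q w x) w HSP).
      eexists; apply (inverse_family_derive _ _ _ Q HB HF HQ); auto.
    + intros w Hw.
      assert (E := f_equal P (proj2 (proj2 (HQ w Hw)) x)).
      set (v := Q w x) in *; cbv beta in E.
      rewrite (lin_minus P _ _ HP), (linear_scal _ HP), (dp_comm' HD), Hx in E.
      unfold shift; rewrite (lin_opp T _ HT), (dp_inv HD), <- E; module_ring.
Qed.

End Local_spectra.

Lemma local_resolvent_Cinv {X : NormedModule C_AbsRing} (T S P : X -> X) (x : X) (z : C) :
  drazin_pair T S P -> z <> 0 ->
  local_resolvent_set T x z -> local_resolvent_set S x (/ z).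
Proof.
  intros HD Hz Hx.
  replace x with (plus (P x) (minus x (P x))) by module_ring.
  apply local_resolvent_set_plus.
  - exact (dp_lin' HD).
  - now apply (local_resolvent_proj_Cinv T S P HD).
  - apply (local_resolvent_nil_part S T P (drazin_pair_sym _ _ _ HD)).
    now apply Cinv_neq_0.
Qed.

(** Adding [0] matters: the inverses of an unbounded set accumulate there. *)
Lemma closed_Cinv (Omega : C -> Prop) :
  closed Omega -> closed (fun z : C => z = 0 \/ Omega (/ z)).
Proof.
  intros HO z Hz; apply NNPP; intros Hn.
  assert (Hz0 : z <> RtoC 0) by tauto.
  apply Hz.
  assert (Hloc : locally (/ z) (fun w => ~ Omega w)).
  { apply NNPP; intros Hl; apply Hn; right; now apply HO. }
  apply (filter_imp (fun w : C => w <> 0 /\ ~ Omega (/ w))); [tauto|].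
  now apply (locally_Cinv z (fun w => ~ Omega w)).
Qed.

Lemma closed_fixed_points {X : NormedModule C_AbsRing} (P : X -> X) :
  is_linear P -> closed (fun x : X => P x = x).
Proof.
  intros HP.
  assert (HE := is_linear_minus (fun x => x) P is_linear_id HP).
  apply (closed_ext (fun x : X => norm (minus x (P x)) <= 0)%R).
  - intros x; split; intros H.
    + assert (E : minus x (P x) = zero).
      { apply norm_eq_zero, Rle_antisym; [easy|apply norm_ge_0]. }
      replace (P x) with (minus x (minus x (P x))) by module_ring.
      rewrite E; module_ring.
    + rewrite H; replace (minus x x) with (zero : X) by module_ring.
      right; exact norm_zero.
  - apply (closed_comp (fun x : X => norm (minus x (P x))) (fun r => r <= 0)%R).
    + intros x; eapply filterlim_comp.
      * exact (linear_cont (fun x => minus x (P x)) x HE).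
      * apply filterlim_norm.
    + apply closed_le.
Qed.

(** The local spectral subspace of [S] for [Omega] is the one of [T] for the
    inverted set, cut down to the fixed points of [P] when [0] is not in [Omega];
    both are closed. *)
Lemma property_C_drazin_pair {X : CompleteNormedModule C_AbsRing} (T S P : X -> X) :
  drazin_pair T S P -> property_C T -> property_C S.
Proof.
  intros HD HC Omega HO.
  assert (HD' := drazin_pair_sym _ _ _ HD).
  apply (closed_ext (fun x : X =>
    local_spectral_subspace T (fun z : C => z = 0 \/ Omega (/ z)) x /\
    (Omega 0 \/ P x = x))).
  - intros x; rewrite !local_spectral_subspace_iff; split.
    + intros [HT H0] z Hz.
      destruct (classic (z = 0)) as [->|Hz0].
      * destruct H0 as [H0|H0]; [easy|].
        apply (local_resolvent_at_0 S T P HD'); [|easy].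
        apply invertible_near_identity, (dp_lin HD).
      * assert (Hiz := Cinv_neq_0 z Hz0).
        assert (Ez : / / z = z) by (field; auto).
        rewrite <- Ez; apply (local_resolvent_Cinv T S P); auto.
        apply HT; rewrite Ez; tauto.
    + intros HS; split.
      * intros z Hz.
        assert (Hz0 : z <> 0) by tauto.
        assert (Hiz := Cinv_neq_0 z Hz0).
        assert (Ez : / / z = z) by (field; auto).
        rewrite <- Ez; apply (local_resolvent_Cinv S T P); auto.
      * destruct (classic (Omega 0)) as [H0|H0]; [now left|right].
        apply (proj_of_local_resolvent_0 S T P HD'); auto.
  - apply closed_and.
    + now apply HC, closed_Cinv.
    + destruct (classic (Omega 0)) as [H0|H0].
      * apply (closed_ext (fun _ => True)); [tauto|apply closed_true].
      * apply (closed_ext (fun x : X => P x = x)); [tauto|].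
        exact (closed_fixed_points (X := X) P (dp_proj_lin HD)).
Qed.

Theorem theorem4p6 (X : CompleteNormedModule C_AbsRing)
    (HX : ~ finite_dimensional X) (T TD : X -> X)
    (HT : is_linear T) (HTD : is_gen_Drazin_inverse T TD) :
  property_C T <-> property_C TD.
Proof.
  assert (HD := gen_Drazin_inverse_pair T TD HT HTD).
  split; eapply property_C_drazin_pair.
  - exact HD.
  - exact (drazin_pair_sym _ _ _ HD).
Qed.
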